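(* Let $\mathbf X$ be a non-empty set. If there does not exist any metric $d$ on $\mathbf X$ such that $\inf_{x,y\in\mathbf X,\ x\ne y}d(x,y)=0$, then $\mathcal D(\mathbf X)\setminus\{O\}$ has a basis.
   Context: $\mathbb K$ is the field of real or complex numbers and $\mathbb K^*=\mathbb K\setminus\{0\}$. $\mathcal D(\mathbf X)$ is the set of all metrics on $\mathbf X$ together with the constant zero function $O$ on $\mathbf X\times\mathbf X$, with $(\rho+\eta)(x,y)=\rho(x,y)+\eta(x,y)$, $(\alpha\rho)(x,y)=|\alpha|\rho(x,y)$ for $\alpha\in\mathbb K$, and $\rho\le\eta$ iff $\rho(x,y)\le\eta(x,y)$ for all $x,y\in\mathbf X$; its set of minimal elements is $\{O\}$. For $\rho\in\mathcal D(\mathbf X)\setminus\{O\}$, $L(\rho):=\{\eta\in\mathcal D(\mathbf X):\eta\ge\alpha\rho\text{ for some }\alpha\in\mathbb K^*\}$. Two elements $\rho,\eta\in\mathcal D(\mathbf X)\setminus\{O\}$ are orderly dependent if $\rho\in L(\eta)$ or $\eta\in L(\rho)$, and orderly independent otherwise; a subset of $\mathcal D(\mathbf X)\setminus\{O\}$ is orderly independent if any two distinct members of it are orderly independent. A subset $B\subseteq\mathcal D(\mathbf X)\setminus\{O\}$ is a generator of $\mathcal D(\mathbf X)\setminus\{O\}$ if $\mathcal D(\mathbf X)\setminus\{O\}=\bigcup_{\rho\in B}L(\rho)$, and a basis if it is an orderly independent generator. The infimum over the empty set is $+\infty$. *)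

(* Defs.v *)
From Stdlib Require Import Reals Ensembles.
From Coquelicot Require Import Coquelicot.

Set Implicit Arguments.
Unset Strict Implicit.

Open Scope R_scope.

Record is_metric (X : Type) (d : X -> X -> R) : Prop := IsMetric {
  metric_nonneg : forall x y, 0 <= d x y;
  metric_eq0 : forall x y, d x y = 0 <-> x = y;
  metric_sym : forall x y, d x y = d y x;
  metric_triangle : forall x y z, d x z <= d x y + d y z
}.

Definition zero_dist (X : Type) : X -> X -> R := fun _ _ => 0.

Definition D (X : Type) : Ensemble (X -> X -> R) :=
  fun rho => is_metric rho \/ rho = @zero_dist X.

Definition Dstar (X : Type) : Ensemble (X -> X -> R) :=
  Setminus _ (@D X) (Singleton _ (@zero_dist X)).

(* The field of scalars is a Coquelicot [AbsRing], whose absolute value [abs]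
   is real-valued; it is meant to be [R_AbsRing] or [C_AbsRing] (for which
   [abs] is [Rabs], respectively [Cmod]). *)
Definition dist_scal (K : AbsRing) (X : Type) (alpha : K) (rho : X -> X -> R) :
    X -> X -> R :=
  fun x y => abs alpha * rho x y.

Definition dist_le (X : Type) (rho eta : X -> X -> R) : Prop :=
  forall x y, rho x y <= eta x y.

Definition L (K : AbsRing) (X : Type) (rho : X -> X -> R) :
    Ensemble (X -> X -> R) :=
  fun eta => In _ (@D X) eta /\
    exists alpha : K, alpha <> zero /\ dist_le (dist_scal alpha rho) eta.

Definition orderly_dependent (K : AbsRing) (X : Type) (rho eta : X -> X -> R) :
    Prop :=
  In _ (L K eta) rho \/ In _ (L K rho) eta.

Definition orderly_independent (K : AbsRing) (X : Type)
    (B : Ensemble (X -> X -> R)) : Prop :=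
  Included _ B (@Dstar X) /\
  forall rho eta, In _ B rho -> In _ B eta -> rho <> eta ->
    ~ orderly_dependent K rho eta.

Definition is_generator (K : AbsRing) (X : Type)
    (B : Ensemble (X -> X -> R)) : Prop :=
  Included _ B (@Dstar X) /\
  Same_set _ (@Dstar X) (fun eta => exists rho, In _ B rho /\ In _ (L K rho) eta).

Definition is_basis (K : AbsRing) (X : Type)
    (B : Ensemble (X -> X -> R)) : Prop :=
  orderly_independent K B /\ is_generator K B.

(* [Glb_Rbar] of the empty set is [p_infty]: this is the value when [X] has
   only one point. *)
Definition inf_dist (X : Type) (d : X -> X -> R) : Rbar :=
  Glb_Rbar (fun r => exists x y, x <> y /\ r = d x y).

(* Main.v *)
(* When no metric has infimum 0, every metric is bounded below off the diagonal
   by a positive constant, hence dominates a positive multiple of the discrete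
   metric: the discrete metric alone is a basis. On a one-point set the discrete
   metric is [O] and the basis is empty. *)
Require Import Defs.
From Stdlib Require Import Reals Ensembles Lra.
From Stdlib Require Import ClassicalEpsilon FunctionalExtensionality.
From Coquelicot Require Import Coquelicot.

Definition discrete_dist (X : Type) : X -> X -> R :=
  fun x y => if excluded_middle_informative (x = y) then 0 else 1.

Lemma discrete_dist_metric (X : Type) : is_metric (@discrete_dist X).
Proof.
  unfold discrete_dist; split.
  - intros x y; destruct (excluded_middle_informative (x = y)); lra.
  - intros x y; destruct (excluded_middle_informative (x = y)) as [e | n].
    + tauto.
    + split; [lra | tauto].
  - intros x y; destruct (excluded_middle_informative (x = y)),
      (excluded_middle_informative (y = x)); congruence.
  (* The inequality would read [1 <= 0 + 0] only if [x = y] and [y = z] while [x <> z], which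
     [congruence] refutes. *)
  - intros x y z; destruct (excluded_middle_informative (x = z)),
      (excluded_middle_informative (x = y)),
      (excluded_middle_informative (y = z)); try lra; congruence.
Qed.

Lemma abs_pos (K : AbsRing) (alpha : K) : alpha <> zero -> 0 < abs alpha.
Proof.
  intros H.
  destruct (abs_ge_0 alpha) as [h | h]; [exact h |].
  exfalso; apply H, abs_eq_zero; auto.
Qed.

(** This turns a real lower bound into a scalar. The value group of an arbitrary [AbsRing] may miss
    [r]; in both fields the real number [r] is its own witness. *)
Lemma abs_surj_pos (K : AbsRing) (hK : K = R_AbsRing \/ K = C_AbsRing) (r : R) :
  0 < r -> exists alpha : K, alpha <> zero /\ abs alpha = r.
Proof.
  intros Hr.
  enough (exists alpha : K, abs alpha = r) as [alpha Ha].
  { exists alpha; split; [intros -> | exact Ha].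
    rewrite abs_zero in Ha; lra. }
  destruct hK as [-> | ->].
  - exists r; apply Rabs_pos_eq; lra.
  - exists (RtoC r); unfold abs; simpl.
    rewrite Cmod_R; apply Rabs_pos_eq; lra.
Qed.

(** A finite infimum serves as [c] itself: it is nonnegative because 0 is a lower bound, and nonzero
    by assumption. *)
Lemma inf_dist_neq0_lower_bound (X : Type) (d : X -> X -> R) :
  is_metric d -> inf_dist d <> Finite 0 ->
  exists c, 0 < c /\ forall x y, x <> y -> c <= d x y.
Proof.
  intros Hd H0.
  unfold inf_dist in H0.
  match type of H0 with Glb_Rbar ?E <> _ =>
    pose proof (Glb_Rbar_correct E) as [Hlb Hglb] end.
  specialize (Hglb (Finite 0)).
  destruct (Glb_Rbar _) as [r | |].
  - exists r; split.
    + assert (H : 0 <= r).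
      { apply Hglb; intros s (x & y & _ & ->); apply (metric_nonneg Hd). }
      destruct H as [H | <-]; [exact H | now contradict H0].
    + intros x y Hxy; apply (Hlb (d x y)); eauto.
  (* An infimum of [p_infty] means that no two points are distinct, so any positive constant will
     do. *)
  - exists 1; split; [lra |].
    intros x y Hxy; destruct (Hlb (d x y)); eauto.
  (* The value [m_infty] is impossible, since 0 is a lower bound. *)
  - destruct Hglb.
    intros s (x & y & _ & ->); apply (metric_nonneg Hd).
Qed.

Lemma Dstar_metric (X : Type) (eta : X -> X -> R) :
  In _ (@Dstar X) eta -> is_metric eta.
Proof.
  intros [[H | ->] Hn]; [exact H | destruct Hn; constructor].
Qed.

Lemma metric_Dstar (X : Type) (eta : X -> X -> R) (x y : X) :
  is_metric eta -> x <> y -> In _ (@Dstar X) eta.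
Proof.
  intros H Hxy; split; [now left |].
  intros Hz; destruct Hz.
  apply Hxy, (metric_eq0 H); reflexivity.
Qed.

(** Without two distinct points, a metric vanishes everywhere and so equals [zero_dist] by
    extensionality. *)
Lemma Dstar_two_points (X : Type) (eta : X -> X -> R) :
  In _ (@Dstar X) eta -> exists x y : X, x <> y.
Proof.
  intros H.
  apply NNPP; intros Hn.
  pose proof (Dstar_metric _ _ H) as Hm.
  destruct H as [_ Hz]; apply Hz.
  replace eta with (@zero_dist X); [constructor |].
  do 2 (apply functional_extensionality; intro).
  symmetry; apply (metric_eq0 Hm), NNPP; eauto.
Qed.

(** A nonzero multiple of [rho] is positive at a pair of distinct points, so [zero_dist] cannot
    dominate it. *)
Lemma L_subset_Dstar (K : AbsRing) (X : Type) (rho : X -> X -> R) :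
  In _ (@Dstar X) rho -> Included _ (L K rho) (@Dstar X).
Proof.
  intros Hrho eta [HD (alpha & Ha & Hle)].
  destruct (Dstar_two_points _ _ Hrho) as (x & y & Hxy).
  destruct HD as [Hm | ->]; [now apply metric_Dstar with x y |].
  exfalso; apply Hxy.
  pose proof (Dstar_metric _ _ Hrho) as Hm.
  apply (metric_eq0 Hm).
  pose proof (metric_nonneg Hm x y).
  pose proof (abs_pos _ _ Ha).
  specialize (Hle x y); unfold dist_scal, zero_dist in Hle; nra.
Qed.

Lemma Dstar_subset_L_discrete (K : AbsRing)
    (hK : K = R_AbsRing \/ K = C_AbsRing) (X : Type)
    (hinf : ~ exists d : X -> X -> R, is_metric d /\ inf_dist d = Finite 0) :
  Included _ (@Dstar X) (L K (@discrete_dist X)).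
Proof.
  intros eta Heta.
  split; [apply Heta |].
  pose proof (Dstar_metric _ _ Heta) as Hm.
  destruct (inf_dist_neq0_lower_bound _ _ Hm) as (c & Hc & Hle); [eauto |].
  destruct (abs_surj_pos K hK c Hc) as (alpha & Ha & Hac).
  exists alpha; split; [exact Ha |].
  intros x y; unfold dist_scal, discrete_dist; rewrite Hac.
  destruct (excluded_middle_informative (x = y)) as [_ | n].
  - pose proof (metric_nonneg Hm x y); lra.
  - specialize (Hle x y n); lra.
Qed.

Theorem theorem4p26 (K : AbsRing) (hK : K = R_AbsRing \/ K = C_AbsRing)
    (X : Type) (hX : inhabited X)
    (hinf : ~ exists d : X -> X -> R, is_metric d /\ inf_dist d = Finite 0) :
  exists B : Ensemble (X -> X -> R), is_basis K B.
Proof.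
  (* The second conjunct makes this set empty when the discrete metric is [zero_dist] and a
     singleton otherwise, so no case split on [X] is made. *)
  exists (fun rho => rho = @discrete_dist X /\ In _ (@Dstar X) rho).
  split; [split | split; [| split]].
  - now intros rho [_ H].
  - intros rho eta [-> _] [-> _] H; now contradict H.
  - now intros rho [_ H].
  - intros eta Heta; exists (@discrete_dist X); split.
    + split; [reflexivity |].
      (* The mere existence of [eta] supplies the two points that put the discrete metric in
         [Dstar]. *)
      destruct (Dstar_two_points _ _ Heta) as (x & y & Hxy).
      exact (metric_Dstar _ _ x y (discrete_dist_metric X) Hxy).
    + exact (Dstar_subset_L_discrete K hK X hinf eta Heta).
  - intros eta (rho & [_ Hrho] & HL).
    exact (L_subset_Dstar K X rho Hrho eta HL).
Qed.
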